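(* Let $Z$ be a finite set of potential participants. The outcome of the VCG auction $(L,w)$ lies in $\mathrm{Core}(L,w)$ for all $L\subseteq Z$ if and only if every participant $j\in Z$ displays payoff monotonicity, that is, if and only if for every $j\in Z$ and all sets of participants $S\subseteq S'\subseteq Z$ with $j\in S$, $$J^\star(S'\setminus\{j\})-J^\star(S')\ \le\ J^\star(S\setminus\{j\})-J^\star(S).$$
   Context: Each potential participant $j\in Z$ has offers with power vector $p_j\in\mathbb{R}^{n_j}$ and true cost vector $\bar c_j\in\mathbb{R}^{n_j}$, and bids truthfully. The system operator (TSO) is player $0$, and $n=\sum_{j\in Z}n_j$. For a set of participants $S\subseteq Z$ (taking part together with the TSO), $$J^\star(S)=\min_{x\in\{0,1\}^n,\;y\in\mathbb{R}^p}\ \sum_{j\in Z}\bar c_j^\top x_j+D(x,y)\quad\text{s.t. } g(x,y,p)\le 0,\ \ x_j=0\ \text{for all } j\notin S,$$ where $x_j\in\{0,1\}^{n_j}$ is the block of $x$ belonging to $j$, $D:\{0,1\}^n\times\mathbb{R}^p\to\mathbb{R}$ is an arbitrary function, and $g$ is an arbitrary constraint function not involving costs. It is assumed that the minimum is attained (so $J^\star(S)\in\mathbb{R}$) for every $S\subseteq Z$. For $L\subseteq Z$, the coalitional game $(L,w)$ has player set $L\cup\{0\}$ and value function $w(S\cup\{0\})=-J^\star(S)$ and $w(S)=0$ for $S\subseteq L$ (coalitions without the TSO have value $0$). The core is $$\mathrm{Core}(L,w)=\Big\{u\in\mathbb{R}^{L\cup\{0\}}:\ \sum_{j\in L\cup\{0\}}u_j=-J^\star(L),\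 \ w(T)\le\sum_{j\in T}u_j\ \ \forall\, T\subseteq L\cup\{0\}\Big\}.$$ The outcome of the VCG auction (with Clarke pivot rule and truthful bids) with participants $L$ is the utility vector $u$ with $u_j=J^\star(L\setminus\{j\})-J^\star(L)$ for $j\in L$ and $u_0=-J^\star(L)-\sum_{j\in L}u_j$. *)

(* Defs.v *)
From mathcomp Require Import all_boot all_order all_algebra.
From mathcomp Require Import classical_sets reals.

Set Implicit Arguments.
Unset Strict Implicit.
Unset Printing Implicit Defensive.

Import Order.TTheory GRing.Theory Num.Theory.
Local Open Scope ring_scope.

(* An element of {0,1}^n, with n = \sum_j n_j, given by its blocks
   x_j in {0,1}^(n_j). *)
Definition selection (Z : finType) (n : Z -> nat) :=
  forall j : Z, 'cV[bool]_(n j).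

Record market (R : realType) (Z : finType) := Market {
  offers : Z -> nat;
  dim_y : nat;
  nb_constraints : nat;
  power : forall j, 'cV[R]_(offers j);
  (* Bids are truthful, so these are at once the true and the bid costs. *)
  cost : forall j, 'cV[R]_(offers j);
  D : selection offers -> 'cV[R]_dim_y -> R;
  g : selection offers -> 'cV[R]_dim_y -> (forall j, 'cV[R]_(offers j)) ->
      'cV[R]_nb_constraints
}.

Section Market.
Variables (R : realType) (Z : finType) (M : market R Z).

Definition objective (x : selection (offers M)) (y : 'cV[R]_(dim_y M)) : R :=
  \sum_j ((cost M j)^T *m map_mx (fun b : bool => b%:R) (x j)) 0 0 + D x y.

Definition feasible (S : {set Z}) (x : selection (offers M))
    (y : 'cV[R]_(dim_y M)) : Prop :=
  (forall i, g x y (power M) i 0 <= 0) /\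
  (forall j, j \notin S -> x j = const_mx false).

Definition min_attained (S : {set Z}) : Prop :=
  exists x y, feasible S x y /\
    forall x' y', feasible S x' y' -> objective x y <= objective x' y'.

(* This is the minimum under [min_attained S]; [inf] is only used to make the
   definition total. *)
Definition Jstar (S : {set Z}) : R :=
  inf [set v | exists x y, feasible S x y /\ v = objective x y]%classic.

(* Players are elements of [option Z]: [None] is the system operator (player 0)
   and [Some j] is participant [j]. *)
Definition players (L : {set Z}) : {set option Z} := None |: (Some @: L).

Definition participants (T : {set option Z}) : {set Z} :=
  [set j | Some j \in T].

Definition w (T : {set option Z}) : R :=
  if None \in T then - Jstar (participants T) else 0.

(* A vector of R^(L u {0}) is represented by a function on all of [option Z] of
   which only the coordinates in [players L] matter. *)
Definition core (L : {set Z}) (u : option Z -> R) : Prop :=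
  \sum_(i in players L) u i = - Jstar L /\
  forall T : {set option Z}, T \subset players L -> w T <= \sum_(i in T) u i.

Definition vcg_payoff (L : {set Z}) (j : Z) : R := Jstar (L :\ j) - Jstar L.

Definition vcg_outcome (L : {set Z}) (i : option Z) : R :=
  match i with
  | Some j => vcg_payoff L j
  | None => - Jstar L - \sum_(j in L) vcg_payoff L j
  end.

Definition payoff_monotone (j : Z) : Prop :=
  forall S S' : {set Z}, S \subset S' -> j \in S ->
    Jstar (S' :\ j) - Jstar S' <= Jstar (S :\ j) - Jstar S.

End Market.

(* Main.v *)
Require Import Defs.
From mathcomp Require Import all_boot all_order all_algebra.
From mathcomp Require Import classical_sets reals.
From mathcomp Require Import fintype finset lra.

(** Both conditions concern the marginal costs [J(L \ j) - J(L)] only. Since [J]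
    is antitone, the core constraints without player 0 always hold for the VCG
    outcome; the others say that [\sum_(j in L \ S) (J(L \ j) - J(L))] is at
    most [J(S) - J(L)] for all [S] included in [L]. Payoff monotonicity implies
    this by adding the participants of [L \ S] to [S] one at a time. Conversely
    the case where [L \ S] is a pair [{i, j}] gives
    [J(L \ j) - J(L) <= J(L \ {i, j}) - J(L \ i)], which is payoff monotonicity
    for sets differing by one element, and the general case follows by
    transitivity. *)

Set Implicit Arguments.
Unset Strict Implicit.
Unset Printing Implicit Defensive.

Import Order.TTheory GRing.Theory Num.Theory.
Local Open Scope ring_scope.

Lemma big_option (V : nmodType) (Z : finType) (T : {set option Z})
    (u : option Z -> V) :
  \sum_(i in T) u i =
  (if None \in T then u None else 0) + \sum_(j in participants T) u (Some j).
Proof.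
rewrite big_mkcond (bigD1 None) //=; congr (_ + _).
rewrite (reindex_omap Some id) => [|[]//].
by rewrite -big_mkcondr; apply: eq_bigl => j; rewrite inE eqxx.
Qed.

(** Descending induction from [B], by recursion on the size of [B :\: A]. *)
Lemma setD_ind (Z : finType) (P : {set Z} -> Prop) (B : {set Z}) :
  P B ->
  (forall (A : {set Z}) i, i \notin A -> i |: A \subset B ->
     P (i |: A) -> P A) ->
  forall A : {set Z}, A \subset B -> P A.
Proof.
move=> PB IH A; have [n] := ubnP #|B :\: A|; elim: n A => // n IHn A leBAn sAB.
have [BA0|[i]] := set_0Vmem (B :\: A).
  by have -> : A = B by apply/eqP; rewrite eqEsubset sAB -setD_eq0 BA0 eqxx.
move=> iBA; have /setDP[iB iA] := iBA.
have sub : i |: A \subset B by rewrite subUset sub1set iB.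
apply: (IH _ i) => //; apply: IHn => //.
by move: leBAn; rewrite (cardsD1 i) iBA setUC setDDl.
Qed.

Section Marginals.
Variables (R : realDomainType) (Z : finType) (J : {set Z} -> R).

Lemma sum_marginals_le :
  (forall (j : Z) (S S' : {set Z}), S \subset S' -> j \in S ->
     J (S' :\ j) - J S' <= J (S :\ j) - J S) ->
  forall L S : {set Z}, S \subset L ->
    \sum_(j in L :\: S) (J (L :\ j) - J L) <= J S - J L.
Proof.
move=> mono L; apply: setD_ind => [|A i iA siAL IH].
  by rewrite setDv big_set0 subrr.
have iL : i \in L by apply: (subsetP siAL); rewrite setU11.
rewrite (big_setD1 i) /=; last by rewrite inE iA.
rewrite setDDl [A :|: _]setUC.
(* Monotonicity between [i |: A] and [L] bounds the term of [i] by [J A - J (i |: A)], which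
   telescopes with [IH]. *)
have := mono i _ _ siAL (setU11 _ _); rewrite setU1K // => le_i.
by lra.
Qed.

Lemma marginal_monotone :
  (forall L S : {set Z}, S \subset L ->
    \sum_(j in L :\: S) (J (L :\ j) - J L) <= J S - J L) ->
  forall (j : Z) (S S' : {set Z}), S \subset S' -> j \in S ->
    J (S' :\ j) - J S' <= J (S :\ j) - J S.
Proof.
move=> sum_le j S S'; move: S; apply: setD_ind => // A i iA _ IH jA.
have ij : i != j by apply: contraNneq iA => ->.
apply: le_trans (IH _) _; first by rewrite inE jA orbT.
have sub : A :\ j \subset i |: A.
  by apply: subset_trans (subsetUr _ _); apply: subsetDl.
(* The larger set is [i |: A], not [S']: as [(i |: A) :\ i = A], moving the term of [i] to the right
   leaves [J (A :\ j) - J A]. *)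
have := sum_le _ _ sub.
have -> : (i |: A) :\: (A :\ j) = [set i; j].
  apply/setP => k; rewrite !inE; have [->|kj] := eqVneq k j; first by rewrite jA !orbT.
  by case: eqVneq => [->|] //=; rewrite ?(negbTE iA) ?orbF ?andNb.
rewrite big_setU1 ?inE //= big_set1 setU1K //.
by lra.
Qed.

End Marginals.

Section Market.
Variables (R : realType) (Z : finType) (M : market R Z).

(** The optimal value is both a member and a lower bound of the set whose [inf] is taken. *)
Lemma Jstar_min (S : {set Z}) (x : selection (offers M))
    (y : 'cV[R]_(dim_y M)) :
  feasible S x y ->
  (forall (x' : selection (offers M)) (y' : 'cV[R]_(dim_y M)),
     feasible S x' y' -> objective x y <= objective x' y') ->
  Jstar M S = objective x y.
Proof.
move=> fxy min_xy; apply/le_anti/andP; split.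
  apply: ge_inf; last by exists x, y.
  by exists (objective x y) => _ [x' [y' [f' ->]]]; apply: min_xy.
apply: lb_le_inf; first by exists (objective x y), x, y.
by move=> _ [x' [y' [f' ->]]]; apply: min_xy.
Qed.

(** A minimizer for [S] vanishes outside [S], hence outside [S'], so it is feasible for [S']. *)
Lemma Jstar_antitone (S S' : {set Z}) :
  min_attained M S -> min_attained M S' -> S \subset S' ->
  Jstar M S' <= Jstar M S.
Proof.
move=> [x [y [[gxy xS] min_xy]]] [x' [y' [fxy' min_xy']]] sSS'.
rewrite (Jstar_min (conj gxy xS) min_xy) (Jstar_min fxy' min_xy').
apply: min_xy'; split=> // j jS'; apply: xS.
by apply: contraNN jS'; apply: subsetP.
Qed.

Lemma participants_players (L : {set Z}) : participants (players L) = L.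
Proof. by apply/setP => j; rewrite !inE /= mem_imset //; apply: Some_inj. Qed.

Lemma core_vcgP (L : {set Z}) :
  (forall S : {set Z}, min_attained M S) ->
  core M L (vcg_outcome M L) <->
  forall S : {set Z}, S \subset L ->
    \sum_(j in L :\: S) (Jstar M (L :\ j) - Jstar M L) <=
    Jstar M S - Jstar M L.
Proof.
move=> attained.
have sumL (S : {set Z}) : S \subset L -> \sum_(j in L) vcg_payoff M L j =
    \sum_(j in S) vcg_payoff M L j + \sum_(j in L :\: S) vcg_payoff M L j.
  by move=> sSL; rewrite (big_setID S) /= (setIidPr sSL).
split=> [[_ coreL] S sSL|le_sum].
  (* Player 0 receives [- Jstar M L] minus all payoffs of [L]; adding those of [S] leaves only the
     sum over [L :\: S]. *)
  have := coreL (players S) (setUS _ (imsetS _ sSL)).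
  rewrite /w big_option participants_players setU11 /= (sumL S sSL).
  rewrite /vcg_payoff; lra.
split=> [|T sTL].
  by rewrite big_option participants_players setU11 /= subrK.
have sPL : participants T \subset L.
  rewrite -(participants_players L).
  by apply/subsetP => j; rewrite !inE => /(subsetP sTL); rewrite !inE.
rewrite /w big_option; case: ifP => _ /=.
  have := le_sum _ sPL; rewrite (sumL _ sPL) /vcg_payoff; lra.
rewrite add0r; apply: sumr_ge0 => j _.
by rewrite subr_ge0 Jstar_antitone ?subD1set.
Qed.

End Market.

Theorem theorem2 (R : realType) (Z : finType) (M : market R Z)
    (attained : forall S : {set Z}, min_attained M S) :
  (forall L : {set Z}, core M L (vcg_outcome M L)) <->
  (forall j : Z, payoff_monotone M j).
Proof.
split=> [coreL|mono L].
  by apply: marginal_monotone => L; apply/core_vcgP.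
by apply/core_vcgP => //; apply: sum_marginals_le.
Qed.
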